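(* Let $X$ be a connected, locally path connected and semilocally small generated space. Then every semicovering of $X$ is a covering of $X$.
   Context: $P(X,x)$ is the space of all paths $\alpha:[0,1]\to X$ with $\alpha(0)=x$, with the compact-open topology. A loop $\beta$ in $X$ based at $x$ is small if for every open neighborhood $U$ of $x$ it is homotopic (relative to endpoints) in $X$ to a loop based at $x$ lying in $U$. The small subgroup $\pi_1^s(X,x)$ is the subgroup of $\pi_1(X,x)$ consisting of the homotopy classes of small loops at $x$. The small generated subgroup $\pi_1^{sg}(X,x)$ is the subgroup of $\pi_1(X,x)$ generated by the set $$\{[\alpha*\beta*\alpha^{-1}]\ \mid\ [\beta]\in\pi_1^s(X,\alpha(1)),\ \alpha\in P(X,x)\}.$$ The space $X$ is semilocally small generated if for every $x\in X$ there exists an open neighborhood $U$ of $x$ such that $i_*\pi_1(U,x)\leq\pi_1^{sg}(X,x)$, where $i:U\hookrightarrow X$ is the inclusion. A semicovering (in the sense of Brazas) is a local homeomorphism $p:Y\to X$ with continuous lifting of paths and homotopies. Continuous lifting of paths means that for every $y\in Y$ the map $P(Y,y)\to P(X,p(y))$, $\alpha\mapsto p\circ\alpha$, is a homeomorphism. Continuous lifting of homotopies means that for every $y\in Y$ the map $\Phi(Y,y)\to\Phi(X,p(y))$, $\phi\mapsto p\circ\phi$, is a homeomorphism, where $\Phi(Z,z)$ denotes the space, with the compact-open topology, of continuous maps $(D^2,d)\to(Z,z)$ from the closed unit disk $D^2$ with basepoint $d=(1,0)$. *)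

(* Defs.v *)
From HB Require Import structures.
From mathcomp Require Import all_boot all_order all_algebra generic_quotient.
From mathcomp Require Import ring lra.
From mathcomp Require Import all_classical all_reals all_analysis homotopy.
Import Order.TTheory GRing.Theory Num.Theory.
Import numFieldNormedType.Exports.

Set Implicit Arguments.
Unset Strict Implicit.
Unset Printing Implicit Defensive.

Local Open Scope classical_set_scope.
Local Open Scope ring_scope.
Local Open Scope quotient_scope.

Section unit_interval.
Variable R : realType.

Definition unitI : Type := set_type (`[0, 1]%classic : set R).
HB.instance Definition _ :=
  Topological.copy unitI (set_type (`[0, 1]%classic : set R)).

Lemma clamp_subproof (r : R) :
  Num.max 0 (Num.min 1 r) \in (`[0, 1]%classic : set R).
Proof.
rewrite inE /= in_itv /= le_max lexx /= ge_max ler01 /=.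
by rewrite ge_min lexx.
Qed.

(* nearest-point retraction of R onto [0, 1]; it makes piecewise formulas
   such as a (2 t) total *)
Definition clamp (r : R) : unitI := SigSub (clamp_subproof r).

Lemma unitI_ge0 (t : unitI) : 0 <= set_val t.
Proof. by have := set_valP t; rewrite set_valE /= in_itv /= => /andP[]. Qed.

Lemma unitI_le1 (t : unitI) : set_val t <= 1.
Proof. by have := set_valP t; rewrite set_valE /= in_itv /= => /andP[]. Qed.

Lemma clampK (r : R) : 0 <= r <= 1 -> set_val (clamp r) = r.
Proof.
by move=> /andP[r0 r1]; rewrite set_valE /= (min_idPr r1) (max_idPr r0).
Qed.

Lemma clamp_val (t : unitI) : clamp (set_val t) = t.
Proof.
by apply: val_inj; rewrite -set_valE clampK // unitI_ge0 unitI_le1.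
Qed.

Lemma clamp_continuous : continuous clamp.
Proof.
apply: (@continuous_comp_initial _ R R) => r /=.
apply: (@continuous_max R R); first exact: cvg_cst.
by apply: (@continuous_min R R); [exact: cvg_cst|exact: cvg_id].
Qed.

Lemma unitI_val_continuous : continuous (set_val : unitI -> R).
Proof. exact: initial_continuous. Qed.

Lemma unitI_neq01 : clamp 0 != clamp 1.
Proof.
apply/negP => /eqP /(congr1 set_val); rewrite !clampK ?lexx ?ler01 //.
by move/eqP; rewrite eq_sym oner_eq0.
Qed.

HB.instance Definition _ := isBiPointed.Build unitI unitI_neq01.

Lemma val_zero : set_val (zero : unitI) = 0.
Proof. by rewrite clampK ?lexx ?ler01. Qed.

Lemma val_one : set_val (one : unitI) = 1.
Proof. by rewrite clampK ?lexx ?ler01. Qed.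

Lemma clamp0 : clamp 0 = zero. Proof. by []. Qed.
Lemma clamp1 : clamp 1 = one. Proof. by []. Qed.

End unit_interval.


Section continuity.
Variables (R : realType) (X : topologicalType).
Notation I := (unitI R).

Lemma half_continuous (T : topologicalType) (h : T -> R) (f g : T -> X) :
  continuous h -> continuous f -> continuous g ->
  (forall t, h t = 2^-1 -> f t = g t) ->
  continuous (fun t => if h t <= 2^-1 then f t else g t).
Proof.
move=> ch cf cg fg; apply/continuous_subspace_setT.
have -> : [set: T] = [set t | h t <= 2^-1] `|` [set t | 2^-1 <= h t].
  apply/seteqP; split=> // t _ /=.
  by case: (leP (h t) 2^-1) => [|/ltW]; [left|right].
apply: withinU_continuous.
- by apply: (@preimage_closed _ _ _ [set r : R | r <= 2^-1]) => //;
    exact: closed_le.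
- by apply: (@preimage_closed _ _ _ [set r : R | 2^-1 <= r]) => //;
    exact: closed_ge.
- apply: (@subspace_eq_continuous _ _ _ f); last exact: continuous_subspaceT.
  by move=> t; rewrite inE /from_subspace /= => ->.
- apply: (@subspace_eq_continuous _ _ _ g); last exact: continuous_subspaceT.
  move=> t; rewrite inE /from_subspace /= => ht; case: ifPn => // ht'.
  by rewrite fg //; apply/eqP; rewrite eq_le ht' ht.
Qed.

Lemma pair_continuous (T A B : topologicalType) (H : A * B -> X)
    (u : T -> A) (v : T -> B) :
  continuous H -> continuous u -> continuous v ->
  continuous (fun t => H (u t, v t)).
Proof.
move=> cH cu cv t; apply: (@continuous_comp _ _ _ (fun t => (u t, v t)) H).
  by apply: cvg_pair; [exact: cu|exact: cv].
exact: cH.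
Qed.

Lemma comp_clamp_continuous (T : topologicalType) (h : T -> R) :
  continuous h -> continuous (fun t => clamp (h t)).
Proof.
by move=> ch t; apply: continuous_comp; [exact: ch|exact: clamp_continuous].
Qed.

Lemma aff_continuous (T : topologicalType) (u v : R) (h : T -> R) :
  continuous h -> continuous (fun t => u * h t + v).
Proof.
move=> ch t; apply: (@cvgD R R^o); last exact: cvg_cst.
by apply: cvgM; [exact: cvg_cst|exact: ch].
Qed.

Lemma double_continuous (T : topologicalType) (h : T -> R) :
  continuous h -> continuous (fun t => 2 * h t).
Proof. by move=> ch t; apply: cvgM; [exact: cvg_cst|exact: ch]. Qed.

Lemma opp1_continuous (T : topologicalType) (h : T -> R) :
  continuous h -> continuous (fun t => 1 - h t).
Proof.
by move=> ch t; apply: (@cvgB R R^o); [exact: cvg_cst|exact: ch].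
Qed.

Lemma val_fst_continuous : continuous (fun st : I * I => set_val st.1).
Proof.
move=> st; apply: (@continuous_comp _ _ _ fst set_val); first exact: cvg_fst.
exact: unitI_val_continuous.
Qed.

Lemma val_snd_continuous : continuous (fun st : I * I => set_val st.2).
Proof.
move=> st; apply: (@continuous_comp _ _ _ snd set_val); first exact: cvg_snd.
exact: unitI_val_continuous.
Qed.

End continuity.

Section paths.
Variables (R : realType) (X : topologicalType).
Notation I := (unitI R).
Implicit Types x y z : X.

Definition concat_fun (a b : I -> X) (t : I) : X :=
  if set_val t <= 2^-1 then a (clamp (2 * set_val t))
  else b (clamp (2 * set_val t - 1)).

Lemma concat_fun_continuous (a b : I -> X) :
  continuous a -> continuous b -> a one = b zero -> continuous (concat_fun a b).
Proof.
move=> ca cb ab; apply: half_continuous.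
- exact: unitI_val_continuous.
- move=> t; apply: continuous_comp; last exact: ca.
  exact/comp_clamp_continuous/double_continuous/unitI_val_continuous.
- move=> t; apply: continuous_comp; last exact: cb.
  exact/comp_clamp_continuous/aff_continuous/unitI_val_continuous.
- by move=> t ->; rewrite mulfV ?pnatr_eq0 // subrr.
Qed.

Section concat.
Variables (x y z : X) (a : {path I from x to y}) (b : {path I from y to z}).

Lemma concat_cts : continuous (concat_fun a b).
Proof.
apply: concat_fun_continuous; [exact: cts_fun|exact: cts_fun|].
by rewrite path_one path_zero.
Qed.

Lemma concat_zero : concat_fun a b zero = x.
Proof.
by rewrite /concat_fun val_zero mulr0 invr_ge0 ler0n clamp0 path_zero.
Qed.

Lemma concat_one : concat_fun a b one = z.
Proof.
rewrite /concat_fun val_one mulr1 ifF; last first.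
  by apply/negbTE; rewrite -ltNge; lra.
by rewrite (_ : 2 - 1 = 1 :> R) ?clamp1 ?path_one //; lra.
Qed.

Definition concat : {path I from x to z} :=
  mk_path concat_cts concat_zero concat_one.
End concat.

Section rev.
Variables (x y : X) (a : {path I from x to y}).

Definition rev_fun (t : I) : X := a (clamp (1 - set_val t)).

Lemma rev_cts : continuous rev_fun.
Proof.
rewrite /rev_fun => t.
apply: (@continuous_comp _ _ _ (fun t : I => clamp (1 - set_val t)) a);
  last exact: cts_fun.
exact/comp_clamp_continuous/opp1_continuous/unitI_val_continuous.
Qed.

Lemma rev_zero : rev_fun zero = y.
Proof. by rewrite /rev_fun val_zero subr0 clamp1 path_one. Qed.

Lemma rev_one : rev_fun one = x.
Proof. by rewrite /rev_fun val_one subrr clamp0 path_zero. Qed.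

Definition rev_path : {path I from y to x} := mk_path rev_cts rev_zero rev_one.
End rev.

(* homotopy relative to the endpoints; the second coordinate is the time *)
Definition homotopic x y (a b : {path I from x to y}) : Prop :=
  exists H : I * I -> X, [/\ continuous H,
    forall s, H (s, zero) = a s,
    forall s, H (s, one) = b s &
    forall t, H (zero, t) = x /\ H (one, t) = y].

Lemma homotopic_reparam x y x' y' (a : {path I from x to y})
    (f g : I -> R) (b c : {path I from x' to y'}) :
  continuous f -> continuous g -> f zero = g zero -> f one = g one ->
  (forall s, b s = a (clamp (f s))) -> (forall s, c s = a (clamp (g s))) ->
  homotopic b c.
Proof.
move=> cf cg fg0 fg1 bE cE.
pose L (st : I * I) : R := f st.1 + set_val st.2 * (g st.1 - f st.1).
exists (fun st => a (clamp (L st))); split.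
- move=> st; apply: (@continuous_comp _ _ _ (fun st => clamp (L st)) a);
    last exact: cts_fun.
  apply: comp_clamp_continuous => {}st.
  have cf1 : continuous (fun st : I * I => f st.1).
    move=> u; apply: (@continuous_comp _ _ _ fst f); last exact: cf.
    exact: cvg_fst.
  have cg1 : continuous (fun st : I * I => g st.1).
    move=> u; apply: (@continuous_comp _ _ _ fst g); last exact: cg.
    exact: cvg_fst.
  apply: (@cvgD R R^o); first exact: cf1.
  apply: cvgM; first exact: val_snd_continuous.
  by apply: (@cvgB R R^o); [exact: cg1|exact: cf1].
- by move=> s; rewrite /L /= val_zero mul0r addr0 bE.
- by move=> s; rewrite /L /= val_one mul1r addrC subrK cE.
- move=> t; rewrite /L /= fg0 fg1 !subrr !mulr0 !addr0 -fg0 -fg1 -!bE.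
  by rewrite path_zero path_one.
Qed.

Lemma homotopic_refl x y (a : {path I from x to y}) : homotopic a a.
Proof.
by apply: (@homotopic_reparam _ _ _ _ a set_val set_val) => //;
  [exact: unitI_val_continuous..|move=> s|move=> s]; rewrite clamp_val.
Qed.

Lemma homotopic_sym x y (a b : {path I from x to y}) :
  homotopic a b -> homotopic b a.
Proof.
move=> [H [cH Ha Hb Hxy]].
exists (fun st => H (st.1, clamp (1 - set_val st.2))); split.
- apply: (pair_continuous cH); first by move=> st; exact: cvg_fst.
  exact/comp_clamp_continuous/opp1_continuous/val_snd_continuous.
- by move=> s; rewrite /= val_zero subr0 clamp1 Hb.
- by move=> s; rewrite /= val_one subrr clamp0 Ha.
- by move=> t; exact: Hxy.
Qed.

Lemma homotopic_trans x y (a b c : {path I from x to y}) :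
  homotopic a b -> homotopic b c -> homotopic a c.
Proof.
move=> [H [cH Ha Hb Hxy]] [K [cK Kb Kc Kxy]].
exists (fun st => if set_val st.2 <= 2^-1
                  then H (st.1, clamp (2 * set_val st.2))
                  else K (st.1, clamp (2 * set_val st.2 - 1))); split.
- apply: half_continuous.
  + exact: val_snd_continuous.
  + apply: (pair_continuous cH); first by move=> st; exact: cvg_fst.
    exact/comp_clamp_continuous/double_continuous/val_snd_continuous.
  + apply: (pair_continuous cK); first by move=> st; exact: cvg_fst.
    exact/comp_clamp_continuous/aff_continuous/val_snd_continuous.
  + by move=> st ->; rewrite mulfV ?pnatr_eq0 // subrr clamp0 clamp1 Hb Kb.
- by move=> s /=; rewrite val_zero mulr0 invr_ge0 ler0n clamp0 Ha.
- move=> s /=; rewrite val_one mulr1 ifF; last first.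
    by apply/negbTE; rewrite -ltNge; lra.
  by rewrite (_ : 2 - 1 = 1 :> R) ?clamp1 ?Kc //; lra.
- by move=> t /=; case: ifP => _; [exact: Hxy|exact: Kxy].
Qed.

Lemma homotopic_concat x y z (a a' : {path I from x to y})
    (b b' : {path I from y to z}) :
  homotopic a a' -> homotopic b b' -> homotopic (concat a b) (concat a' b').
Proof.
move=> [H [cH Ha Ha' Hxy]] [K [cK Kb Kb' Kxy]].
exists (fun st => if set_val st.1 <= 2^-1
                  then H (clamp (2 * set_val st.1), st.2)
                  else K (clamp (2 * set_val st.1 - 1), st.2)); split.
- apply: half_continuous.
  + exact: val_fst_continuous.
  + apply: (pair_continuous cH); last by move=> st; exact: cvg_snd.
    exact/comp_clamp_continuous/double_continuous/val_fst_continuous.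
  + apply: (pair_continuous cK); last by move=> st; exact: cvg_snd.
    exact/comp_clamp_continuous/aff_continuous/val_fst_continuous.
  + move=> st ->; rewrite mulfV ?pnatr_eq0 // subrr clamp0 clamp1.
    by rewrite (Hxy _).2 (Kxy _).1.
- by move=> s /=; rewrite Ha Kb.
- by move=> s /=; rewrite Ha' Kb'.
- move=> t /=; split.
    by rewrite val_zero mulr0 invr_ge0 ler0n clamp0 (Hxy _).1.
  rewrite val_one mulr1 ifF; last by apply/negbTE; rewrite -ltNge; lra.
  by rewrite (_ : 2 - 1 = 1 :> R) ?clamp1 ?(Kxy _).2 //; lra.
Qed.

Lemma homotopic_rev x y (a b : {path I from x to y}) :
  homotopic a b -> homotopic (rev_path a) (rev_path b).
Proof.
move=> [H [cH Ha Hb Hxy]].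
exists (fun st => H (clamp (1 - set_val st.1), st.2)); split.
- apply: (pair_continuous cH); last by move=> st; exact: cvg_snd.
  exact/comp_clamp_continuous/opp1_continuous/val_fst_continuous.
- by move=> s; rewrite Ha.
- by move=> s; rewrite Hb.
- move=> t /=; rewrite val_zero val_one subr0 subrr clamp0 clamp1.
  by split; [exact: (Hxy t).2|exact: (Hxy t).1].
Qed.

Definition cst_path x : {path I from x to x} := cst x.

Lemma minr_continuous (f g : I -> R) : continuous f -> continuous g ->
  continuous (fun t => Num.min (f t) (g t)).
Proof.
by move=> cf cg t; apply: (@continuous_min R); [exact: cf|exact: cg].
Qed.

Lemma maxr_continuous (f g : I -> R) : continuous f -> continuous g ->
  continuous (fun t => Num.max (f t) (g t)).
Proof.
by move=> cf cg t; apply: (@continuous_max R); [exact: cf|exact: cg].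
Qed.

Lemma homotopic_concatA x y z w (a : {path I from x to y})
    (b : {path I from y to z}) (c : {path I from z to w}) :
  homotopic (concat a (concat b c)) (concat (concat a b) c).
Proof.
apply: (@homotopic_reparam _ _ _ _ (concat a (concat b c)) set_val
  (fun s => Num.min (2 * set_val s)
    (Num.min (1 * set_val s + 4^-1) (2^-1 * set_val s + 2^-1)))).
- exact: unitI_val_continuous.
- apply: minr_continuous; first exact/double_continuous/unitI_val_continuous.
  by apply: minr_continuous; exact/aff_continuous/unitI_val_continuous.
- by rewrite val_zero !minEle; do ?case: ifPn; lra.
- by rewrite val_one !minEle; do ?case: ifPn; lra.
- by move=> s; rewrite clamp_val.
- move=> s; have s0 := unitI_ge0 s; have s1 := unitI_le1 s.
  set m := Num.min _ _.
  have mE : m = if set_val s <= 4^-1 then 2 * set_val s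
                else if set_val s <= 2^-1 then set_val s + 4^-1
                else 2^-1 * set_val s + 2^-1.
    by rewrite /m !minEle; do ?case: ifPn; lra.
  have m01 : 0 <= m <= 1 by rewrite mE; do ?case: ifPn; lra.
  rewrite /= /mk_path /concat_fun /= /mk_path /concat_fun (clampK m01).
  case: (leP (set_val s) 2^-1) => hs.
  + have h2 : 0 <= 2 * set_val s <= 1 by lra.
    rewrite (clampK h2).
    case: (leP (set_val s) 4^-1) mE => hs' mE.
    * rewrite ifT; last lra.
      by rewrite ifT ?mE //; lra.
    * have h3 : 0 <= 2 * m - 1 <= 1 by rewrite mE hs; lra.
      rewrite hs in mE; rewrite ifF; last by apply/negbTE; rewrite -ltNge; lra.
      rewrite ifF; last by apply/negbTE; rewrite -ltNge; lra.
      rewrite (clampK h3) ifT; last lra.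
      by congr (b (clamp _)); lra.
  + rewrite ifF in mE; last by apply/negbTE; rewrite -ltNge; lra.
    rewrite ifF in mE; last by apply/negbTE; rewrite -ltNge; lra.
    have h3 : 0 <= 2 * m - 1 <= 1 by lra.
    rewrite ifF; last by apply/negbTE; rewrite -ltNge; lra.
    rewrite (clampK h3) ifF; last by apply/negbTE; rewrite -ltNge; lra.
    by congr (c (clamp _)); lra.
Qed.

Lemma homotopic_concat1p x y (a : {path I from x to y}) :
  homotopic (concat (cst_path x) a) a.
Proof.
apply: (@homotopic_reparam _ _ _ _ a
  (fun s => Num.max 0 (2 * set_val s - 1)) set_val).
- apply: maxr_continuous; first exact: cst_continuous.
  exact/aff_continuous/unitI_val_continuous.
- exact: unitI_val_continuous.
- by rewrite val_zero !maxEle; do ?case: ifPn; lra.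
- by rewrite val_one !maxEle; do ?case: ifPn; lra.
- move=> s; rewrite /= /mk_path /concat_fun; case: ifPn => hs.
    by rewrite (max_idPl _) ?clamp0 ?path_zero //; lra.
  by rewrite (max_idPr _) //; move: hs; rewrite -ltNge; lra.
- by move=> s; rewrite clamp_val.
Qed.

Lemma homotopic_concatp1 x y (a : {path I from x to y}) :
  homotopic (concat a (cst_path y)) a.
Proof.
apply: (@homotopic_reparam _ _ _ _ a
  (fun s => Num.min 1 (2 * set_val s)) set_val).
- apply: minr_continuous; last exact/double_continuous/unitI_val_continuous.
  exact: cst_continuous.
- exact: unitI_val_continuous.
- by rewrite val_zero !minEle; do ?case: ifPn; lra.
- by rewrite val_one !minEle; do ?case: ifPn; lra.
- move=> s; rewrite /= /mk_path /concat_fun; case: ifPn => hs.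
    by rewrite (min_idPr _) //; lra.
  rewrite (min_idPl _) ?clamp1 ?path_one //.
  by move: hs; rewrite -ltNge; lra.
- by move=> s; rewrite clamp_val.
Qed.

Lemma homotopic_concatpV x y (a : {path I from x to y}) :
  homotopic (concat a (rev_path a)) (cst_path x).
Proof.
apply: (@homotopic_reparam _ _ _ _ a
  (fun s => Num.min (2 * set_val s) (- 2 * set_val s + 2)) (cst 0)).
- apply: minr_continuous; first exact/double_continuous/unitI_val_continuous.
  exact/aff_continuous/unitI_val_continuous.
- exact: cst_continuous.
- by rewrite val_zero !minEle; do ?case: ifPn; rewrite /=; lra.
- by rewrite val_one !minEle; do ?case: ifPn; rewrite /=; lra.
- move=> s; have s0 := unitI_ge0 s; have s1 := unitI_le1 s.
  rewrite /= /mk_path /concat_fun; case: (leP (set_val s) 2^-1) => hs.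
    by rewrite (min_idPl _) //; lra.
  rewrite /= /mk_path /rev_fun clampK; last lra.
  rewrite (min_idPr _); last lra.
  by congr (a (clamp _)); lra.
- by move=> s; rewrite /= clamp0 path_zero.
Qed.

Lemma homotopic_concatVp x y (a : {path I from x to y}) :
  homotopic (concat (rev_path a) a) (cst_path y).
Proof.
apply: (@homotopic_reparam _ _ _ _ a
  (fun s => Num.max (1 - 2 * set_val s) (2 * set_val s - 1)) (cst 1)).
- apply: maxr_continuous.
    exact/opp1_continuous/double_continuous/unitI_val_continuous.
  exact/aff_continuous/unitI_val_continuous.
- exact: cst_continuous.
- by rewrite val_zero !maxEle; do ?case: ifPn; rewrite /=; lra.
- by rewrite val_one !maxEle; do ?case: ifPn; rewrite /=; lra.
- move=> s; have s0 := unitI_ge0 s; have s1 := unitI_le1 s.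
  rewrite /= /mk_path /concat_fun; case: (leP (set_val s) 2^-1) => hs.
    rewrite (max_idPl _); last lra.
    by rewrite /= /mk_path /rev_fun clampK //; lra.
  by rewrite (max_idPr _) //; lra.
- by move=> s; rewrite /= clamp1 path_one.
Qed.

End paths.

Section fundamental_group.
Variables (R : realType) (X : topologicalType) (x : X).
Notation I := (unitI R).

Definition loop_equiv : rel {path I from x to x} :=
  fun a b => `[< homotopic a b >].

Lemma loop_equiv_class : equiv_class_of loop_equiv.
Proof.
split.
- by move=> a; apply/asboolP; exact: homotopic_refl.
- by move=> a b; apply/asboolP/asboolP; exact: homotopic_sym.
- by move=> b a c /asboolP ab /asboolP bc; apply/asboolP/(homotopic_trans ab).
Qed.

Canonical loop_equiv_rel := EquivRelPack loop_equiv_class.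

Definition pi1 : Type := {eq_quot loop_equiv_rel}.
HB.instance Definition _ := Choice.on pi1.
HB.instance Definition _ := Quotient.on pi1.

Definition pi1_class (a : {path I from x to x}) : pi1 := \pi_pi1 a.

Lemma pi1_classP (a b : {path I from x to x}) :
  pi1_class a = pi1_class b <-> homotopic a b.
Proof.
split=> [/eqmodP/asboolP //|ab]; apply/eqmodP; exact/asboolP.
Qed.

Lemma pi1_classK (c : pi1) : pi1_class (repr c) = c.
Proof. exact: reprK. Qed.

Definition pi1_one : pi1 := pi1_class (cst_path R x).
Definition pi1_mul (c d : pi1) : pi1 := pi1_class (concat (repr c) (repr d)).
Definition pi1_inv (c : pi1) : pi1 := pi1_class (rev_path (repr c)).

Lemma repr_class (a : {path I from x to x}) : homotopic (repr (pi1_class a)) a.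
Proof. by apply/pi1_classP; rewrite pi1_classK. Qed.

Lemma pi1_mulE (a b : {path I from x to x}) :
  pi1_mul (pi1_class a) (pi1_class b) = pi1_class (concat a b).
Proof. by apply/pi1_classP/homotopic_concat; exact: repr_class. Qed.

Lemma pi1_invE (a : {path I from x to x}) :
  pi1_inv (pi1_class a) = pi1_class (rev_path a).
Proof. exact/pi1_classP/homotopic_rev/repr_class. Qed.

Lemma pi1_mulA : associative pi1_mul.
Proof.
move=> c d e; rewrite -(pi1_classK c) -(pi1_classK d) -(pi1_classK e) !pi1_mulE.
exact/pi1_classP/homotopic_concatA.
Qed.

Lemma pi1_mul1g : left_id pi1_one pi1_mul.
Proof.
move=> c; rewrite -(pi1_classK c) pi1_mulE.
exact/pi1_classP/homotopic_concat1p.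
Qed.

Lemma pi1_mulg1 : right_id pi1_one pi1_mul.
Proof.
move=> c; rewrite -(pi1_classK c) pi1_mulE.
exact/pi1_classP/homotopic_concatp1.
Qed.

Lemma pi1_mulVg : left_inverse pi1_one pi1_inv pi1_mul.
Proof.
move=> c; rewrite -(pi1_classK c) pi1_invE pi1_mulE.
exact/pi1_classP/homotopic_concatVp.
Qed.

Lemma pi1_mulgV : right_inverse pi1_one pi1_inv pi1_mul.
Proof.
move=> c; rewrite -(pi1_classK c) pi1_invE pi1_mulE.
exact/pi1_classP/homotopic_concatpV.
Qed.

HB.instance Definition _ :=
  isGroup.Build pi1 pi1_mulA pi1_mul1g pi1_mulg1 pi1_mulVg pi1_mulgV.

End fundamental_group.

Section induced_map.
Variables (R : realType) (X Y : topologicalType) (f : continuousType X Y).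
Variable x : X.

Definition pi1_map (c : pi1 R x) : pi1 R (f x) := pi1_class (f \o repr c).

Lemma pi1_mapE (a : {path unitI R from x to x}) :
  pi1_map (pi1_class a) = pi1_class (f \o a).
Proof.
apply/pi1_classP; have [H [cH H0 H1 Hx]] := repr_class a.
exists (f \o H); split=> [|s|s|t] /=.
- by move=> st; apply: continuous_comp; [exact: cH|exact: cts_fun].
- by rewrite H0.
- by rewrite H1.
- by rewrite (Hx t).1 (Hx t).2.
Qed.

End induced_map.

HB.instance Definition _ (X : topologicalType) (U : set X) :=
  isContinuous.Build _ _ (set_val : set_type U -> X)
    (@initial_continuous (set_type U) X set_val).

Definition generated_subgroup (G : groupType) (S : set G) : set G :=
  smallest [set H : set G | group_closed (mem H)] S.

Section small_loops.
Variables (R : realType) (X : topologicalType).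
Notation I := (unitI R).

Definition small_loop (x : X) (b : {path I from x to x}) : Prop :=
  forall U : set X, open U -> U x ->
    exists2 b' : {path I from x to x}, range b' `<=` U & homotopic b b'.

Definition pi1_small (x : X) : set (pi1 R x) :=
  @pi1_class R X x @` [set b | small_loop b].

Lemma concat_range (x y z : X) (a : {path I from x to y})
    (b : {path I from y to z}) (U : set X) :
  range a `<=` U -> range b `<=` U -> range (concat a b) `<=` U.
Proof.
move=> aU bU _ [t _ <-]; rewrite /= /mk_path /concat_fun.
by case: ifP => _; [apply: aU|apply: bU]; exact: imageT.
Qed.

Lemma pi1_small_group_closed (x : X) : group_closed (mem (@pi1_small x)).
Proof.
split.
  apply/mem_set; exists (cst_path R x) => // U _ Ux.
  by exists (cst_path R x); [move=> _ [t _ <-]|exact: homotopic_refl].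
move=> _ _ /set_mem[b bs <-] /set_mem[c cs <-]; apply/mem_set.
exists (concat b (rev_path c)) => [U oU Ux|].
  have [b' b'U bb'] := bs U oU Ux; have [c' c'U cc'] := cs U oU Ux.
  exists (concat b' (rev_path c')).
    by apply: concat_range => // _ [t _ <-]; apply: c'U; exact: imageT.
  by apply: homotopic_concat => //; exact: homotopic_rev.
by rewrite -pi1_mulE -pi1_invE.
Qed.

Definition pi1_sg (x : X) : set (pi1 R x) :=
  generated_subgroup [set c | exists y (a : {path I from x to y})
      (b : {path I from y to y}),
    pi1_small (pi1_class b) /\
    c = pi1_class (concat (concat a b) (rev_path a))].

Definition semilocally_small_generated : Prop :=
  forall x : X, exists U : set X, exists xU : x \in U,
    open U /\
    range (@pi1_map R _ _ set_val (SigSub xU : set_type U)) `<=` @pi1_sg x.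

Definition path_connected (A : set X) : Prop :=
  forall x y, A x -> A y -> exists a : {path I from x to y}, range a `<=` A.

Definition locally_path_connected : Prop :=
  forall (x : X) (U : set X), open U -> U x ->
    exists V : set X, [/\ open V, V x, V `<=` U & path_connected V].

End small_loops.

Arguments pi1_small R {X} x _.
Arguments pi1_sg R {X} x _.

Section maps.
Implicit Types S T : topologicalType.

Definition homeomorphism S T (f : S -> T) : Prop :=
  continuous f /\ exists g : T -> S, [/\ cancel f g, cancel g f & continuous g].

(* f restricts to a homeomorphism from the subspace A to the subspace B *)
Definition homeomorphism_on S T (f : S -> T) (A : set S) (B : set T) : Prop :=
  exists2 h : set_type A -> set_type B,
    (forall s, set_val (h s) = f (set_val s)) & homeomorphism h.

Definition local_homeomorphism S T (f : S -> T) : Prop :=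
  forall s : S, exists U : set S,
    [/\ open U, U s, open (f @` U) & homeomorphism_on f U (f @` U)].

Definition evenly_covered S T (p : S -> T) (U : set T) : Prop :=
  exists F : set (set S),
    [/\ trivIset F id, p @^-1` U = \bigcup_(V in F) V &
      forall V, F V -> open V /\ homeomorphism_on p V U].

(* fibres are allowed to be empty, so surjectivity is not part of the
   definition *)
Definition covering S T (p : S -> T) : Prop :=
  continuous p /\
  forall t : T, exists U : set T, [/\ open U, U t & evenly_covered p U].

Definition path_space (R : realType) T (x : T) :
    set {compact-open, unitI R -> T} :=
  [set a : unitI R -> T | continuous a /\ a zero = x].

Arguments path_space R {T} x _.

Definition closed_disk (R : realType) : set (R * R) :=
  [set z | z.1 ^+ 2 + z.2 ^+ 2 <= 1].
Arguments closed_disk : clear implicits.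

Lemma disk_base_subproof (R : realType) : (1, 0) \in closed_disk R.
Proof. by rewrite inE /closed_disk /= expr1n expr0n addr0. Qed.

Definition disk_base (R : realType) : set_type (closed_disk R) :=
  SigSub (disk_base_subproof R).

Definition disk_space (R : realType) T (x : T) :
    set {compact-open, set_type (closed_disk R) -> T} :=
  [set phi : set_type (closed_disk R) -> T |
    continuous phi /\ phi (disk_base R) = x].

Arguments disk_space R {T} x _.

Definition continuous_path_lifting (R : realType) S T (p : S -> T) : Prop :=
  forall s : S, @homeomorphism_on {compact-open, unitI R -> S}
    {compact-open, unitI R -> T}
    (comp p) (path_space R s) (path_space R (p s)).

Definition continuous_homotopy_lifting (R : realType) S T (p : S -> T) : Prop :=
  forall s : S, @homeomorphism_on {compact-open, set_type (closed_disk R) -> S}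
    {compact-open, set_type (closed_disk R) -> T}
    (comp p) (disk_space R s) (disk_space R (p s)).

Definition semicovering (R : realType) S T (p : S -> T) : Prop :=
  [/\ local_homeomorphism p, continuous_path_lifting R p &
      continuous_homotopy_lifting R p].

End maps.

(* Main.v *)
(* The classes of loops at [x] all of whose lifts are loops form a subgroup of
   the fundamental group.  It contains the conjugates of small loops, because a
   small loop is homotopic to one in a sheet of the local homeomorphism [p],
   hence it contains the small generated subgroup.  So if [U] is as in the
   definition of semilocally small generated and [V] is a path connected open
   neighbourhood of [x] inside [U], every loop in [V] lifts to loops, and the
   lifts of the paths in [V] starting at [x] sweep out disjoint sheets over
   [V], one for each point of the fibre over [x]. *)

Require Import Defs.
From mathcomp Require Import all_boot all_order all_algebra.
From mathcomp Require Import lra.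
From mathcomp Require Import all_classical all_reals all_analysis homotopy.
Import Order.TTheory GRing.Theory Num.Theory.
Import numFieldNormedType.Exports.

Set Implicit Arguments.
Unset Strict Implicit.
Unset Printing Implicit Defensive.

Local Open Scope classical_set_scope.
Local Open Scope ring_scope.

(* [all_boot] shadows it with an unrelated lemma of [path]. *)
Local Notation rev_path := Defs.rev_path.

(** * Homeomorphisms between subspaces and local homeomorphisms *)

Section homeomorphisms.
Variables S T : topologicalType.
Implicit Types (f : S -> T) (A : set S) (B : set T).

Lemma homeomorphism_on_surj f A B t :
  homeomorphism_on f A B -> B t -> exists2 s, A s & f s = t.
Proof.
move=> [h hE [_ [g [_ hg _]]]] Bt.
exists (set_val (g (SigSub (mem_set Bt)))); first exact: set_valP.
by rewrite -hE hg.
Qed.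

Lemma homeomorphism_on_inj f A B s s' :
  homeomorphism_on f A B -> A s -> A s' -> f s = f s' -> s = s'.
Proof.
move=> [h hE [_ [g [gh _ _]]]] As As' fss'.
have : h (SigSub (mem_set As)) = h (SigSub (mem_set As')).
  by apply: val_inj; rewrite -!set_valE !hE.
by move=> /(can_inj gh)/(congr1 val).
Qed.

Lemma homeomorphism_on_lift (Z : topologicalType) f A B (a : Z -> T) :
  homeomorphism_on f A B -> continuous a -> (forall z, B (a z)) ->
  exists2 b : Z -> S, continuous b & forall z, A (b z) /\ f (b z) = a z.
Proof.
move=> [h hE [_ [g [_ hg cg]]]] ca Ba.
pose a' z : set_type B := SigSub (mem_set (Ba z)).
have ca' : continuous a' by apply: (@continuous_comp_initial _ Z T).
exists (fun z => set_val (g (a' z))) => z.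
  apply: (@continuous_comp _ _ _ (g \o a') set_val).
    by apply: continuous_comp; [exact: ca'|exact: cg].
  exact: initial_continuous.
by split; [exact: set_valP|rewrite -hE hg].
Qed.

(** The inverse pulls an open [W] back to the image of its intersection with [A], which is open
    because [f] is an open map. *)
Lemma homeomorphism_on_open f A B : continuous f ->
  (forall O, open O -> open (f @` O)) ->
  open A -> (forall s s', A s -> A s' -> f s = f s' -> s = s') ->
  f @` A = B -> homeomorphism_on f A B.
Proof.
move=> cf of_ oA fI fAB.
have fA (s : set_type A) : B (f (set_val s)).
  by rewrite -fAB; exists (set_val s) => //; exact: set_valP.
pose h s : set_type B := SigSub (mem_set (fA s)).
have Bf (t : set_type B) : exists s : set_type A, h s = t.
  have [s As fs] : (f @` A) (set_val t) by rewrite fAB; exact: set_valP.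
  exists (SigSub (mem_set As)); apply: val_inj => /=.
  by rewrite -set_valE.
have [g hg] := choice Bf.
have gh : cancel h g.
  move=> s; have fss' := congr1 val (hg (h s)).
  by apply: val_inj; apply: fI => //; exact: set_valP.
exists h; first by [].
split.
  apply: (@continuous_comp_initial _ (set_type A) T) => s.
  apply: (@continuous_comp _ _ _ set_val f); last exact: cf.
  exact: initial_continuous.
exists g; split => //; apply/continuousP => _ [W oW <-].
exists (f @` (W `&` A)); first exact/of_/openI.
apply/seteqP; split=> t /=.
  move=> [s [Ws As] fs].
  suff -> : set_val (g t) = s by [].
  apply: fI => //; first exact: set_valP.
  by rewrite fs -[in RHS](hg t).
move=> Wgt; exists (set_val (g t)).
  by split => //; exact: set_valP.
by rewrite -[in RHS](hg t).
Qed.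

Lemma local_homeomorphism_continuous f :
  local_homeomorphism f -> continuous f.
Proof.
move=> fl s; have [U [oU Us _ [h hE [ch _]]]] := fl s.
move=> N; rewrite nbhsE => -[ O [oO Ofs] ON].
have /continuousP/(_ (set_val @^-1` O))[] := ch; first by exists O.
move=> W oW WE.
have fWU s' : U s' -> W s' <-> O (f s').
  move=> Us'; have := congr1 (fun P => P (SigSub (mem_set Us'))) WE.
  by rewrite /= hE /= !set_valE /= => ->.
rewrite nbhs_simpl /=.
apply: (@filterS _ _ _ (W `&` U)).
  by move=> s' [Ws' Us']; apply: ON; apply/fWU.
apply: open_nbhs_nbhs; split; first exact: openI.
by split => //; apply/fWU.
Qed.

Lemma local_homeomorphism_open f O :
  local_homeomorphism f -> open O -> open (f @` O).
Proof.
move=> fl oO; rewrite openE => _ [s Os <-].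
have [U [oU Us ofU [h hE [ch [g [gh hg cg]]]]]] := fl s.
(* The inverse pulls [O] back to the trace of some open [W] on the image of [U]; that image is open,
   and the trace lies in the image of [O]. *)
have /continuousP/(_ (set_val @^-1` O))[] := cg; first by exists O.
move=> W oW WE.
rewrite /interior /=; apply: (@filterS _ _ _ (W `&` (f @` U))).
  move=> t [Wt fUt].
  pose t' : set_type (f @` U) := SigSub (mem_set fUt).
  have E : W t = O (set_val (g t')) := congr1 (fun P => P t') WE.
  exists (set_val (g t')); last by rewrite -hE hg.
  by rewrite -E.
apply: open_nbhs_nbhs; split; first exact: openI.
split; last by exists s.
pose s' : set_type U := SigSub (mem_set Us).
have := congr1 (fun P => P (h s')) WE; rewrite /= gh hE.
by move=> ->.
Qed.

End homeomorphisms.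

(** * Lifts of paths along a semicovering *)

Section semicoverings.
Variables (R : realType) (X Y : topologicalType) (p : Y -> X).
Hypothesis psemi : semicovering R p.
Notation I := (unitI R).

Lemma semicovering_continuous : continuous p.
Proof. by case: psemi => pl _ _; exact: local_homeomorphism_continuous. Qed.

Lemma semicovering_open O : open O -> open (p @` O).
Proof. by case: psemi => pl _ _; exact: local_homeomorphism_open. Qed.

(** Existence of lifts is surjectivity of [comp p] on path spaces; uniqueness, next, is its
    injectivity. *)
Lemma path_lift (a : I -> X) y : continuous a -> a zero = p y ->
  exists f : I -> Y, [/\ continuous f, f zero = y & p \o f = a].
Proof.
case: psemi => _ pp _ ca a0.
have [f [cf f0] fE] := homeomorphism_on_surj (pp y) (conj ca a0 : @path_space R X (p y) a).
by exists f.
Qed.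

Lemma path_lift_unique (f g : I -> Y) : continuous f -> continuous g ->
  f zero = g zero -> p \o f = p \o g -> f = g.
Proof.
case: psemi => _ pp _ cf cg fg0 fg.
exact: (homeomorphism_on_inj (pp (g zero)) (conj cf fg0) (conj cg erefl) fg).
Qed.

Lemma disk_lift (phi : set_type (@closed_disk R) -> X) y :
  continuous phi -> phi (disk_base R) = p y ->
  exists psi : set_type (@closed_disk R) -> Y,
    [/\ continuous psi, psi (disk_base R) = y & p \o psi = phi].
Proof.
case: psemi => _ _ ph cphi phi0.
have [f [cf f0] fE] :=
  homeomorphism_on_surj (ph y) (conj cphi phi0 : @disk_space R X (p y) phi).
by exists f.
Qed.

Lemma lift_of_cst (f : I -> Y) x : continuous f -> (forall t, p (f t) = x) ->
  f zero = f one.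
Proof.
move=> cf pf; suff -> : f = cst (f zero) by [].
apply: path_lift_unique => //; first exact: cst_continuous.
by apply/funext => t /=; rewrite !pf.
Qed.

(** Monodromy along [a], as a relation between points of the fibres over its ends; no choice of
    lifts is involved. *)
Definition lifts_to (a : I -> X) (y z : Y) : Prop :=
  exists f : I -> Y, [/\ continuous f, p \o f = a, f zero = y & f one = z].

Lemma lifts_to_total x x' (a : {path I from x to x'}) y : p y = x ->
  exists z, lifts_to a y z.
Proof.
move=> pyx; have a0 : a zero = p y by rewrite path_zero.
have [f [cf f0 fE]] := path_lift (@cts_fun _ _ a) a0.
by exists (f one); exists f.
Qed.

Lemma lifts_to_fun a y z z' : lifts_to a y z -> lifts_to a y z' -> z = z'.
Proof.
move=> [f [cf fE f0 <-]] [g [cg gE g0 <-]].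
by rewrite (path_lift_unique cf cg) ?f0 ?g0 ?fE ?gE.
Qed.

Lemma lifts_to_cst y : lifts_to (cst_path R (p y)) y y.
Proof. by exists (cst y); split => //; exact: cst_continuous. Qed.

Lemma lifts_to_source x x' (a : {path I from x to x'}) y z :
  lifts_to a y z -> p y = x.
Proof.
by move=> [f [_ fE <- _]]; rewrite -[LHS]/((p \o f) zero) fE path_zero.
Qed.

Lemma lifts_to_target x x' (a : {path I from x to x'}) y z :
  lifts_to a y z -> p z = x'.
Proof.
by move=> [f [_ fE _ <-]]; rewrite -[LHS]/((p \o f) one) fE path_one.
Qed.

Lemma lifts_to_concat x x' x'' (a : {path I from x to x'})
    (b : {path I from x' to x''}) y z w :
  lifts_to a y z -> lifts_to b z w -> lifts_to (concat a b) y w.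
Proof.
move=> [f [cf fE f0 f1]] [g [cg gE g0 g1]].
pose f' : {path I from y to z} := mk_path cf f0 f1.
pose g' : {path I from z to w} := mk_path cg g0 g1.
exists (concat f' g'); split; [exact: cts_fun| |exact: path_zero|exact: path_one].
apply/funext => t; rewrite /= /mk_path /concat_fun -fE -gE /=.
by case: ifP.
Qed.

Lemma lifts_to_rev x x' (a : {path I from x to x'}) y z :
  lifts_to (rev_path a) y z <-> lifts_to a z y.
Proof.
split.
- move=> [f [cf fE f0 f1]].
  pose f' : {path I from y to z} := mk_path cf f0 f1.
  exists (rev_path f'); split; [exact: cts_fun| |exact: path_zero|exact: path_one].
  apply/funext => t; rewrite /= /mk_path /rev_fun /= /mk_path.
  have := congr1 (fun h => h (clamp (1 - set_val t))) fE; rewrite /= => ->.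
  rewrite /mk_path /rev_fun clampK; last first.
    by have := unitI_ge0 t; have := unitI_le1 t; lra.
  by rewrite (_ : 1 - (1 - set_val t) = set_val t) ?clamp_val //; lra.
- move=> [f [cf fE f0 f1]].
  pose f' : {path I from z to y} := mk_path cf f0 f1.
  exists (rev_path f'); split; [exact: cts_fun| |exact: path_zero|exact: path_one].
  by apply/funext => t; rewrite /= /mk_path /rev_fun /= /mk_path -fE.
Qed.

(** * Homotopy invariance of the endpoints of lifts *)

Lemma clamp_le0 (r : R) : r <= 0 -> clamp r = zero.
Proof.
move=> r0; apply: val_inj => /=.
by rewrite !minEle !maxEle; do ?case: ifPn; lra.
Qed.

Lemma disk_map (Z : topologicalType) (u v : Z -> R) :
  continuous u -> continuous v ->
  (forall z, u z ^+ 2 + v z ^+ 2 <= 1) ->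
  exists2 D : Z -> set_type (@closed_disk R), continuous D &
    forall z, set_val (D z) = (u z, v z).
Proof.
move=> cu cv uv; pose w z := (u z, v z).
have wd z : w z \in @closed_disk R by apply/mem_set/uv.
exists (fun z => SigSub (wd z)); last by [].
have cw : continuous (fun z => (u z, v z)).
  by move=> z; apply: (cvg_pair (cu z) (cv z)).
by apply: (@continuous_comp_initial _ Z (R * R)%type).
Qed.

(* The square is a retract of the disk: [J] embeds it as the square of side 1
   centred at the origin, and [q] projects the disk back onto it coordinatewise.
   The basepoint (1, 0) projects to the left side of the square, on which the
   homotopy is constant. *)
Lemma lifts_to_homotopic x x' (a b : {path I from x to x'}) y z :
  homotopic a b -> lifts_to a y z -> lifts_to b y z.
Proof.
move=> [H [cH Ha Hb Hx]] ayz.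
have pyx := lifts_to_source ayz.
(* The first coordinate is reversed, so that all points with abscissa at least 1/2 go to the side
   [s = 0], where [H] is constant. *)
pose q (d : set_type (@closed_disk R)) : I * I :=
  (clamp (- 1 * (set_val d).1 + 2^-1), clamp (1 * (set_val d).2 + 2^-1)).
have cval : continuous (set_val : set_type (@closed_disk R) -> R * R).
  exact: initial_continuous.
have cq : continuous (H \o q).
  have c1 : continuous (fun d : set_type (@closed_disk R) => (set_val d).1).
    move=> d; apply: (@continuous_comp _ _ _ set_val fst); first exact: cval.
    exact: cvg_fst.
  have c2 : continuous (fun d : set_type (@closed_disk R) => (set_val d).2).
    move=> d; apply: (@continuous_comp _ _ _ set_val snd); first exact: cval.
    exact: cvg_snd.
  by apply: (pair_continuous cH);
    apply: comp_clamp_continuous; exact: aff_continuous.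
have Hq0 : (H \o q) (disk_base R) = p y.
  rewrite pyx /= /q clamp_le0 ?(Hx _).1 //.
  by rewrite set_valE /=; lra.
have [psi [cpsi psi0 psiE]] := disk_lift cq Hq0.
have [||st|J cJ JE] := @disk_map (I * I)%type
    (fun st => - 1 * set_val st.1 + 2^-1) (fun st => 1 * set_val st.2 + - 2^-1).
- exact/aff_continuous/val_fst_continuous.
- exact/aff_continuous/val_snd_continuous.
- have := unitI_ge0 st.1; have := unitI_le1 st.1.
  have := unitI_ge0 st.2; have := unitI_le1 st.2; nra.
have qJ st : q (J st) = st.
  case: st => s t; rewrite /q JE /= -[in RHS](clamp_val s) -[in RHS](clamp_val t).
  by congr (clamp _, clamp _); lra.
pose G st := psi (J st).
have cG : continuous G.
  by move=> st; apply: continuous_comp; [exact: cJ|exact: cpsi].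
have pG st : p (G st) = H st.
  by rewrite -[LHS]/((p \o psi) (J st)) psiE /= qJ.
have cGs t : continuous (fun s => G (s, t)).
  by apply: (pair_continuous cG) => [s|]; [exact: cvg_id|exact: cst_continuous].
have cGt s : continuous (fun t => G (s, t)).
  by apply: (pair_continuous cG) => [|t]; [exact: cst_continuous|exact: cvg_id].
(* The segment [D] from the basepoint to [J (zero, t)] keeps its abscissa at least 1/2, so [psi]
   lifts a constant path along it and keeps the value [y]. *)
have G0 t : G (zero, t) = y.
  have t0 := unitI_ge0 t; have t1 := unitI_le1 t.
  have [||r|D cD DE] := @disk_map I
      (fun r => (- 2^-1) * set_val r + 1)
      (fun r => (set_val t - 2^-1) * set_val r + 0).
  - exact/aff_continuous/unitI_val_continuous.
  - exact/aff_continuous/unitI_val_continuous.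
  - have r0 := unitI_ge0 r; have r1 := unitI_le1 r.
    set u := set_val t - 2^-1.
    have hu : u ^+ 2 <= 4^-1 by rewrite /u; nra.
    rewrite addr0 exprMn; set v := set_val r in r0 r1 *.
    have : u ^+ 2 * v ^+ 2 <= 4^-1 * v ^+ 2.
      by rewrite ler_wpM2r // sqr_ge0.
    nra.
  rewrite /G; have <- : D one = J (zero, t).
    by apply: val_inj; rewrite -!set_valE DE JE val_one val_zero; congr pair; lra.
  have D0 : D zero = disk_base R.
    apply: val_inj; rewrite -set_valE DE val_zero /=.
    by rewrite !mulr0 !add0r.
  rewrite -psi0 -D0; apply/esym.
  apply: (@lift_of_cst (psi \o D) x) => [r|r].
    by apply: continuous_comp; [exact: cD|exact: cpsi].
  rewrite -[LHS]/((p \o psi) (D r)) psiE /= /q DE /= clamp_le0 ?(Hx _).1 //.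
  have := unitI_le1 r; lra.
have G1 : G (one, zero) = G (one, one).
  by apply: (@lift_of_cst _ x' (cGt one)) => t; rewrite pG (Hx t).2.
(* The sides [t = 0] and [t = 1] of [G] lift [a] and [b] from [y], and by [G1] they end at the same
   point. *)
have -> : z = G (one, zero).
  apply: lifts_to_fun ayz _; exists (fun s => G (s, zero)); split => //.
  by apply/funext => s /=; rewrite pG Ha.
rewrite G1; exists (fun s => G (s, one)); split => //.
by apply/funext => s /=; rewrite pG Hb.
Qed.

(** * Loops all of whose lifts are loops *)

Lemma small_loop_lifts x (b : {path I from x to x}) y :
  small_loop b -> p y = x -> lifts_to b y y.
Proof.
move=> bs pyx; have [pl _ _] := psemi; have [W [_ Wy opW hW]] := pl y.
have [|b' b'W bb'] := bs _ opW; first by exists y.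
apply: lifts_to_homotopic (homotopic_sym bb') _.
have b'W' t : (p @` W) (b' t) by apply: b'W; exact: imageT.
(* This lift stays in [W], where [p] is injective; both its ends lie over [x], hence equal [y]. *)
have [f cf fE] := homeomorphism_on_lift (a := b') hW (@cts_fun _ _ b') b'W'.
exists f; split=> //; first by apply/funext => t; exact: (fE t).2.
  apply: (homeomorphism_on_inj hW (fE _).1 Wy).
  by rewrite (fE _).2 path_zero.
apply: (homeomorphism_on_inj hW (fE _).1 Wy).
by rewrite (fE _).2 path_one.
Qed.

(** The kernel of the monodromy action on the fibre over [x]. By homotopy invariance the choice of
    representative is immaterial. *)
Definition pi1_lifts (x : X) : set (pi1 R x) :=
  [set c : pi1 R x | forall y, p y = x ->
    lifts_to (repr c : {path I from x to x}) y y].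

Lemma pi1_liftsP x (a : {path I from x to x}) :
  pi1_lifts (pi1_class a) <-> forall y, p y = x -> lifts_to a y y.
Proof.
have ra := repr_class a; split=> h y /h; apply: lifts_to_homotopic => //.
exact: homotopic_sym.
Qed.

Lemma pi1_lifts_group_closed x : group_closed (mem (@pi1_lifts x)).
Proof.
split; first by apply/mem_set/pi1_liftsP => y <-; exact: lifts_to_cst.
move=> c d /set_mem cl /set_mem dl; apply/mem_set.
rewrite -(pi1_classK c) -(pi1_classK d) in cl dl *.
move/pi1_liftsP: cl => cl; move/pi1_liftsP: dl => dl.
have -> : (pi1_class (repr c) / pi1_class (repr d))%g =
    pi1_class (concat (repr c) (rev_path (repr d))).
  by rewrite -pi1_mulE -pi1_invE.
apply/pi1_liftsP => y pyx; apply: lifts_to_concat (cl _ pyx) _.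
exact/lifts_to_rev/dl.
Qed.

Lemma pi1_sg_lifts x : pi1_sg R x `<=` @pi1_lifts x.
Proof.
apply: smallest_sub; first exact: pi1_lifts_group_closed.
move=> _ [x' [a [b [[b' b's bb'] ->]]]]; apply/pi1_liftsP => y pyx.
(* The path [a] leads from [y] to [z], the loop [b], homotopic to a small one, closes up at [z], and
   the reverse of [a] returns to [y]. *)
have [z ayz] := lifts_to_total a pyx.
apply: lifts_to_concat (_ : lifts_to _ y z) _; last exact/lifts_to_rev.
apply: (lifts_to_concat ayz).
apply: (@lifts_to_homotopic _ _ b'); first exact/pi1_classP.
exact: small_loop_lifts b's (lifts_to_target ayz).
Qed.

(* Since loops in [V] at [x] lift to loops, the endpoint of the lift at [y] of
   a path in [V] from [x] depends only on the endpoint of that path; the set of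
   these endpoints is the sheet through [y]. *)
Definition sheet (V : set X) (y : Y) : set Y :=
  [set z | exists2 a : {path I from p y to p z},
    range a `<=` V & lifts_to a y z].

(** * Sheets over a path connected open set *)

Section sheets.
Variables (V : set X) (x : X).
Hypotheses (oV : open V) (Vx : V x) (pcV : path_connected R V).
Hypothesis lpcX : locally_path_connected R X.
Hypothesis loopsV : forall a : {path I from x to x},
  range a `<=` V -> forall y, p y = x -> lifts_to a y y.

Lemma rev_range x1 x2 (a : {path I from x1 to x2}) :
  range a `<=` V -> range (rev_path a) `<=` V.
Proof. by move=> aV _ [t _ <-]; apply: aV; exact: imageT. Qed.

Lemma sheet_sub y : sheet V y `<=` p @^-1` V.
Proof. by move=> z [a aV _]; apply: aV; exists one => //; exact: path_one. Qed.

Lemma sheetP y z v (a : {path I from x to v}) :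
  p y = x -> range a `<=` V -> lifts_to a y z -> sheet V y z.
Proof.
move=> pyx aV ayz; have pzv := lifts_to_target ayz.
by subst x v; exists a.
Qed.

Lemma sheet_inv y z : p y = x -> sheet V y z ->
  exists2 a : {path I from x to p z}, range a `<=` V & lifts_to a y z.
Proof. by move=> <- [a aV ayz]; exists a. Qed.

Lemma sheet_inj y z z' : p y = x -> sheet V y z -> sheet V y z' ->
  p z = p z' -> z = z'.
Proof.
move=> pyx /(sheet_inv pyx)[a aV ayz] /(sheet_inv pyx)[b bV byz'] zz'.
move: a aV ayz; rewrite zz' => a aV ayz.
have [w bzw] := lifts_to_total (rev_path b) zz'.
(* This loop lifts to a loop at [y], so the reverse of [b] leads from [z] back to [y]; then [b]
   lifts from [y] to both [z] and [z']. *)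
have /loopsV/(_ _ pyx) : range (concat a (rev_path b)) `<=` V.
  by apply: concat_range => //; exact: rev_range.
move=> /lifts_to_fun/(_ (lifts_to_concat ayz bzw)) yw; subst w.
by move/lifts_to_rev: bzw => /lifts_to_fun; exact.
Qed.

(** Going to [z] from [y] and back to [y'] lifts a loop in [V], so the two ends coincide. *)
Lemma sheet_disjoint y y' z : p y = x -> p y' = x ->
  sheet V y z -> sheet V y' z -> y = y'.
Proof.
move=> pyx py'x /(sheet_inv pyx)[a aV ayz] /(sheet_inv py'x)[b bV by'z].
have /loopsV/(_ _ pyx) : range (concat a (rev_path b)) `<=` V.
  by apply: concat_range => //; exact: rev_range.
move/lifts_to_fun; apply; apply: (lifts_to_concat ayz).
exact/lifts_to_rev.
Qed.

Lemma sheet_cover z : V (p z) -> exists2 y, p y = x & sheet V y z.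
Proof.
move=> Vpz; have [a aV] := pcV Vx Vpz.
(* The wanted point of the fibre is found by lifting backwards from [z]. *)
have [y azy] := lifts_to_total (rev_path a) (erefl (p z)).
have pyx := lifts_to_target azy.
by exists y => //; apply: (sheetP pyx aV); exact/lifts_to_rev.
Qed.

Lemma sheet_image y : p y = x -> p @` sheet V y = V.
Proof.
move=> pyx; apply/seteqP; split=> [_ [z yz <-]|v Vv]; first exact: sheet_sub yz.
have [a aV] := pcV Vx Vv; have [z ayz] := lifts_to_total a pyx.
by exists z; [exact: sheetP aV ayz|exact: lifts_to_target ayz].
Qed.

Lemma sheet_open y : p y = x -> open (sheet V y).
Proof.
move=> pyx; rewrite openE => z yz.
have [a aV ayz] := sheet_inv pyx yz.
have [pl _ _] := psemi; have [W [oW Wz opW hW]] := pl z.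
have [||V' [oV' V'z V'W pcV']] := lpcX (_ : open (p @` W `&` V)) (_ : _ (p z)).
- exact: openI.
- by split; [exists z|exact: sheet_sub yz].
rewrite /interior /=; apply: (@filterS _ _ _ (W `&` p @^-1` V')); last first.
  apply: open_nbhs_nbhs; split => //; apply: openI => //.
  by move/continuousP: semicovering_continuous; exact.
(* The lift of [b] inside [W] joins [z] to [w] by injectivity of [p] there; appended to the lift of
   [a], it puts [w] in the sheet. *)
move=> w [Ww V'w]; have [b bV'] := pcV' _ _ V'z V'w.
have bW t : (p @` W) (b t) by apply: (V'W _ _).1; apply: bV'; exact: imageT.
have [f cf fE] := homeomorphism_on_lift (a := b) hW (@cts_fun _ _ b) bW.
apply: (@sheetP _ _ _ (concat a b)) => //.
  apply: concat_range => // _ [t _ <-].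
  by apply: (V'W _ _).2; apply: bV'; exact: imageT.
apply: (lifts_to_concat ayz).
exists f; split=> //; first by apply/funext => t; exact: (fE t).2.
  apply: (homeomorphism_on_inj hW (fE _).1 Wz).
  by rewrite (fE _).2 path_zero.
apply: (homeomorphism_on_inj hW (fE _).1 Ww).
by rewrite (fE _).2 path_one.
Qed.

Lemma sheets_evenly_covered : evenly_covered p V.
Proof.
(* One sheet for each point of the fibre over [x]; over an empty fibre the family is empty. *)
exists (sheet V @` (p @^-1` [set x])); split.
- move=> _ _ [y pyx <-] [y' py'x <-] [z [yz y'z]].
  by rewrite (sheet_disjoint pyx py'x yz y'z).
- apply/seteqP; split=> [z /sheet_cover[y pyx yz]|z [_ [y pyx <-] yz]].
    by exists (sheet V y) => //; exists y.
  exact: sheet_sub yz.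
- move=> _ [y pyx <-]; split; first exact: sheet_open.
  apply: homeomorphism_on_open.
  + exact: semicovering_continuous.
  + exact: semicovering_open.
  + exact: sheet_open.
  + by move=> z z'; exact: sheet_inj.
  + exact: sheet_image.
Qed.

End sheets.

End semicoverings.

Theorem theorem4p4 (R : realType) (X : topologicalType)
  (Xconn : connected (@setT X))
  (Xlpc : locally_path_connected R X)
  (Xslsg : semilocally_small_generated R X)
  (Y : topologicalType) (p : Y -> X) (psemi : semicovering R p) :
  covering p.
Proof.
split; first exact: (semicovering_continuous psemi).
move=> x; have [U [xU [oU Usg]]] := Xslsg x.
have [V [oV Vx VU pcV]] := Xlpc x U oU (set_mem xU).
exists V; split=> //.
apply: (sheets_evenly_covered psemi oV Vx pcV Xlpc) => a aV.
apply/(pi1_liftsP psemi); apply: (pi1_sg_lifts psemi); apply: Usg.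
(* The hypothesis on [U] concerns loops of the subspace, so [a] is corestricted to a loop [b] there,
   whose class the inclusion sends to that of [a]. *)
have aU t : a t \in U by apply/mem_set/VU/aV; exact: imageT.
pose a' t : set_type U := SigSub (aU t).
have ca' : continuous a'.
  by apply: (@continuous_comp_initial _ (unitI R) X); exact: cts_fun.
pose u : set_type U := SigSub xU.
have a'0 : a' zero = u by apply: val_inj => /=; exact: path_zero.
have a'1 : a' one = u by apply: val_inj => /=; exact: path_one.
pose b : {path unitI R from u to u} := mk_path ca' a'0 a'1.
exists (pi1_class b) => //; rewrite pi1_mapE.
apply: (congr1 (@pi1_class R X x)).
by apply/path_eqP => t.
Qed.
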